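(* The varieties $\mathcal{I}_{2,0}$, $\mathcal{MID}$ and $\mathcal{JID}$ coincide: $\mathcal{I}_{2,0} = \mathcal{MID} = \mathcal{JID}$. That is, for every implicator groupoid $\mathbf{A}$ the identities $x'' \approx x$, $x \land x \approx x$ and $x \lor x \approx x$ are equivalent in $\mathbf{A}$.
   Context: An implicator groupoid is an algebra $\mathbf A = \langle A, \to, 0 \rangle$, with $\to$ binary and $0$ a constant, which, writing $x' := x \to 0$, satisfies the identities (I) $(x \to y) \to z \approx [(z' \to x) \to (y \to z)']'$ and (I$_0$) $0'' \approx 0$. The variety of implicator groupoids is denoted $\mathcal{I}$. Put $x \land y := (x \to y')'$ and $x \lor y := (x' \land y')'$. The subvarieties $\mathcal{I}_{2,0}$, $\mathcal{MID}$, $\mathcal{JID}$ of $\mathcal{I}$ are defined, relative to $\mathcal{I}$, by $x'' \approx x$, by $x \land x \approx x$, and by $x \lor x \approx x$, respectively. *)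

(* Defs.v *)
(* An algebra of type <2, 0>. *)
Record groupoid0 : Type := Groupoid0 {
  carrier :> Type;
  imp : carrier -> carrier -> carrier;
  zero : carrier
}.

Arguments imp {A} x y : rename.
Arguments zero {A} : rename.

Declare Scope imp_scope.
Delimit Scope imp_scope with imp.

(* The arrow of the algebra is written "-->"; it does not associate. *)
Notation "x --> y" := (imp x y) (at level 55, no associativity) : imp_scope.
Notation "0" := zero : imp_scope.

Local Open Scope imp_scope.

Definition neg {A : groupoid0} (x : A) : A := x --> 0.
Notation "x ^'" := (neg x) (at level 2, left associativity, format "x ^'")
  : imp_scope.

Definition meet {A : groupoid0} (x y : A) : A := (x --> y^')^'.
Notation "x /*\ y" := (meet x y) (at level 45, no associativity) : imp_scope.

Definition join {A : groupoid0} (x y : A) : A := (x^' /*\ y^')^'.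
Notation "x \*/ y" := (join x y) (at level 45, no associativity) : imp_scope.

(* The variety of implicator groupoids; varieties are represented by their
   membership predicates on algebras of type <2, 0>. *)
Definition variety_I (A : groupoid0) : Prop :=
  (forall x y z : A,
     (x --> y) --> z = ((z^' --> x) --> (y --> z)^')^')
  /\ (0 : A)^'^' = 0.

Definition variety_I20 (A : groupoid0) : Prop :=
  variety_I A /\ forall x : A, x^'^' = x.

Definition variety_MID (A : groupoid0) : Prop :=
  variety_I A /\ forall x : A, x /*\ x = x.

Definition variety_JID (A : groupoid0) : Prop :=
  variety_I A /\ forall x : A, x \*/ x = x.

(* Main.v *)
Require Import Defs.

(** Every implicator groupoid satisfies [x'''' = x''] ([neg4]).  Hence the
    identity [x'' = x] holds as soon as every element is of the form [u''].
    Idempotence of either operation gives this: [x \*/ x] is by definition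
    [(x' --> x'')''], and [x /*\ x] is the negation of [x --> x'], so
    that under idempotence every element is a negation, and therefore a
    negation of a negation.

    Conversely, if [x'' = x], then [0'] is a left unit for the arrow and
    [0 --> 0' = 0'].  The instance [(0 --> 0') --> x = (x --> x')'] of (I) then
    reads [x = x /*\ x], and idempotence of the join follows by duality.

    The identity [x'''' = x''] rests on the map [x |-> 0' --> x], which is
    idempotent in general and which a negation applied outside does not see:
    [0' --> x] may replace [x] on either side of [(x --> y)'].  Consequently
    [y''] may replace [y] in [(x --> y)'], and
    [x'''' = (0' --> x'')'' = (0' --> x)'' = x'']. *)

Local Open Scope imp_scope.

Section ImplicatorGroupoid.

Variable A : groupoid0.
Hypothesis HI : variety_I A.

Implicit Types x y z : A.

Lemma imp_imp x y z : (x --> y) --> z = ((z^' --> x) --> (y --> z)^')^'.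
Proof. exact (proj1 HI x y z). Qed.

Lemma neg2_zero : (0 : A)^'^' = 0.
Proof. exact (proj2 HI). Qed.

Lemma neg_imp x y : (x --> y)^' = ((0^' --> x) --> y^'^')^'.
Proof. exact (imp_imp x y 0). Qed.

Lemma neg2_imp0 x : (0^' --> x)^'^' = x^'^'.
Proof.
  pose proof (neg_imp x 0) as H; rewrite neg2_zero in H.
  symmetry; exact H.
Qed.

Lemma neg_imp_imp0r x y : (x --> (0^' --> y))^' = (x --> y)^'.
Proof. now rewrite (neg_imp x (0^' --> y)), neg2_imp0, <- neg_imp. Qed.

(** By (I), [(0 --> x) --> z] depends on [z] only through [z''] and
    [(x --> z)'], neither of which changes when [z] becomes [0' --> z]. *)
Lemma zero_imp_imp0 x y : (0 --> x) --> (0^' --> y) = (0 --> x) --> y.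
Proof.
  rewrite (imp_imp 0 x (0^' --> y)), neg_imp_imp0r.
  change ((0^' --> y)^' --> 0) with ((0^' --> y)^'^').
  rewrite neg2_imp0; symmetry; exact (imp_imp 0 x y).
Qed.

(** The instance [x = 0] of [zero_imp_imp0], as [0 --> 0] is [0']. *)
Lemma imp0_idem x : 0^' --> (0^' --> x) = 0^' --> x.
Proof. exact (zero_imp_imp0 0 x). Qed.

Lemma neg_imp_imp0l x y : ((0^' --> x) --> y)^' = (x --> y)^'.
Proof. now rewrite neg_imp, imp0_idem, <- neg_imp. Qed.

Lemma neg_imp_neg2r x y : (x --> y^'^')^' = (x --> y)^'.
Proof. now rewrite (neg_imp x y), neg_imp_imp0l. Qed.

Lemma neg4 x : x^'^'^'^' = x^'^'.
Proof. now rewrite <- (neg2_imp0 (x^'^')), neg_imp_neg2r, neg2_imp0. Qed.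

Lemma meet_idem_neg2 : (forall x, x /*\ x = x) -> forall x, x^'^' = x.
Proof.
  intros meetxx x.
  rewrite <- (meetxx x); unfold meet at 1 2.
  rewrite <- (meetxx (x --> x^')); unfold meet.
  apply neg4.
Qed.

Lemma join_idem_neg2 : (forall x, x \*/ x = x) -> forall x, x^'^' = x.
Proof.
  intros joinxx x.
  rewrite <- (joinxx x); unfold join, meet.
  apply neg4.
Qed.

Section Involutive.

Hypothesis negK : forall x, x^'^' = x.

Lemma imp0_unit x : 0^' --> x = x.
Proof. now rewrite <- (negK (0^' --> x)), neg2_imp0, negK. Qed.

(** Both sides of (I) at [(0, 0, 0')] simplify by the left unit [0']: the left
    one to [0'], the right one to [(0 --> 0')'']. *)
Lemma zero_imp_neg0 : (0 : A) --> 0^' = 0^'.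
Proof.
  pose proof (imp_imp 0 0 (0^')) as H.
  rewrite negK in H; change ((0 : A) --> 0) with ((0 : A)^') in H.
  now rewrite !imp0_unit, negK in H.
Qed.

Lemma meet_idem x : x /*\ x = x.
Proof.
  pose proof (imp_imp 0 (0^') x) as H.
  change (x^' --> 0) with (x^'^') in H.
  rewrite zero_imp_neg0, negK, imp0_unit in H.
  symmetry; exact H.
Qed.

Lemma join_idem x : x \*/ x = x.
Proof. unfold join; now rewrite meet_idem, negK. Qed.

End Involutive.

End ImplicatorGroupoid.

Theorem theorem2p9 :
  (forall A : groupoid0, variety_I20 A <-> variety_MID A) /\
  (forall A : groupoid0, variety_MID A <-> variety_JID A).
Proof.
  split; intros A; split; intros [HI H]; split; try exact HI.
  - exact (meet_idem A HI H).
  - exact (meet_idem_neg2 A HI H).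
  - exact (join_idem A HI (meet_idem_neg2 A HI H)).
  - exact (meet_idem A HI (join_idem_neg2 A HI H)).
Qed.
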